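(* Let $\mathbb K$ be a field, $R:=\mathbb K[x_0,\ldots,x_N]$, and let $\mathcal A=\{H_1,\ldots,H_s\}$ be a collection of $s\ge N+1$ distinct hyperplanes in $\mathbb P^N$ that meet properly. Let $1\le c\le N$, let $I=I(V_c(\mathcal A))$ be the defining ideal of the star configuration of codimension $c$ with support $\mathcal A$, and let $M=\langle x_0,\ldots,x_N\rangle$ be the irrelevant maximal ideal of $R$. Then for all $m\ge 1$, $I$ satisfies the following properties: \begin{enumerate} \item $I^{(mc)}\subseteq M^{m(c-1)}I^m$. In particular, if ${\rm ht}(I)=N$, then $I^{(mN)}\subseteq M^{m(N-1)}I^m$. \item $I^{(mc-c+1)}\subseteq I^m$ and $I^{(mN-N+1)}\subseteq I^m$. \item $I^{(mc-c+1)}\subseteq M^{(m-1)(c-1)}I^m$. In particular, if ${\rm ht}(I)=N$, then $I^{(mN-N+1)}\subseteq M^{(m-1)(N-1)}I^m$. \item For all $t\geq 1$, one has $\frac{\alpha\left(I^{(t)}\right)}{t}\geq \frac{\alpha\left(I^{(m)}\right)+c-1}{m+c-1}$. \item For all $t\geq 1$, one has $\frac{\alpha\left(I^{(t)}\right)}{t}\geq \frac{\alpha\left(I^{(m)}\right)+N-1}{m+N-1}$. \item For all $t\geq 1$, one has $\frac{\alpha\left(I^{(t)}\right)}{t}\geq \frac{\alpha\left(I\right)+N-1}{N}$. \end{enumerate}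
   Context: Let $\ell_1,\ldots,\ell_s\in R$ be defining linear forms of the hyperplanes, $H_i=V(\ell_i)$. The hyperplanes meet properly if, for every $j$, the intersection of any $j$ of them is either empty or has codimension $j$. For $1\le c\le N$, the star configuration of codimension $c$ with support $\mathcal A$ is $$V_c(\mathcal A):=\bigcup_{1\leq j_1<\cdots<j_c\leq s}H_{j_1}\cap\cdots\cap H_{j_c},$$ its defining ideal is $$I(V_c(\mathcal{A}))=\bigcap_{1\leq j_1<\cdots<j_c\leq s}\langle \ell_{j_1},\ldots,\ell_{j_c}\rangle,$$ and the $m$-th symbolic power of this ideal is $$I(V_c(\mathcal{A}))^{(m)}=\bigcap_{1\leq j_1<\cdots<j_c\leq s}\langle \ell_{j_1},\ldots,\ell_{j_c}\rangle^m.$$ For a homogeneous ideal $J$ of $R$, $\alpha(J)$ denotes the least degree of a nonzero element of $J$, and ${\rm ht}(J)$ its height. *)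

(* Defs.v *)
From HB Require Import structures.
From mathcomp Require Import all_boot all_order all_algebra.
From mathcomp Require Import boolp classical_sets.
From mathcomp Require Import mpoly.

Set Implicit Arguments.
Unset Strict Implicit.
Unset Printing Implicit Defensive.

Import GRing.Theory.
Local Open Scope classical_set_scope.
Local Open Scope ring_scope.

Section Ideals.
Variable R : comNzRingType.
Implicit Types (I J P : set R) (n k : nat).

Definition is_ideal I : Prop :=
  [/\ I 0, forall x y, I x -> I y -> I (x + y)
    & forall a x, I x -> I (a * x)].

Definition prime_ideal P : Prop :=
  [/\ is_ideal P, ~ P 1 & forall x y, P (x * y) -> P x \/ P y].

Definition ideal_span (A : set R) : set R :=
  [set x | exists n (a b : 'I_n -> R),
             (forall i, A (b i)) /\ x = \sum_(i < n) a i * b i].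

Definition ideal_mul I J : set R :=
  ideal_span [set x | exists y z, [/\ I y, J z & x = y * z]].

Definition ideal_exp I n : set R := iter n (ideal_mul I) setT.

(* There are primes Q 0 < Q 1 < ... < Q n = P; the values of Q beyond n are
   irrelevant. *)
Definition prime_chain P n : Prop :=
  exists Q : nat -> set R,
    [/\ forall i, (i <= n)%N -> prime_ideal (Q i),
        forall i, (i < n)%N -> Q i `<` Q i.+1
      & Q n = P].

Definition prime_height P n : Prop :=
  prime_chain P n /\ forall k, prime_chain P k -> (k <= n)%N.

(* ht(I) = n, the minimum of the heights of the primes containing I. Primes of
   infinite height have no [prime_height] and do not affect the minimum. *)
Definition height I n : Prop :=
  (exists P, [/\ prime_ideal P, I `<=` P & prime_height P n]) /\
  forall P k, prime_ideal P -> I `<=` P -> prime_height P k -> (n <= k)%N.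

End Ideals.

Section StarConfigurations.
Variables (K : fieldType) (N : nat).
Local Notation R := {mpoly K[N.+1]}.

(* A linear subvariety of P^N is represented by its affine cone, a subspace W
   of K^(N+1): it is empty iff W = 0, and otherwise has projective dimension
   \dim W - 1, i.e. codimension N + 1 - \dim W. *)
Definition is_hyperplane (W : {vspace 'rV[K]_N.+1}) : Prop := \dim W = N.

Definition defining_form (f : R) (W : {vspace 'rV[K]_N.+1}) : Prop :=
  f \is 1.-homog /\ forall x, x \in W <-> f.@[fun i => x 0 i] = 0.

Definition meet_properly s (H : 'I_s -> {vspace 'rV[K]_N.+1}) : Prop :=
  forall S : {set 'I_s},
    let W := (\bigcap_(i in S) H i)%VS in
    W = 0%VS \/ (\dim W + #|S|)%N = N.+1.

Definition irrelevant_ideal : set R := ideal_span [set f | exists i, f = 'X_i].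

Definition forms_ideal s (l : 'I_s -> R) (S : {set 'I_s}) : set R :=
  ideal_span [set f | exists2 j, j \in S & f = l j].

Definition star_ideal s (l : 'I_s -> R) (c : nat) : set R :=
  [set f | forall S : {set 'I_s}, #|S| = c -> forms_ideal l S f].

Definition star_symbolic_power s (l : 'I_s -> R) (c m : nat) : set R :=
  [set f | forall S : {set 'I_s}, #|S| = c -> ideal_exp (forms_ideal l S) m f].

Definition least_degree (J : set R) (d : nat) : Prop :=
  (exists f, [/\ J f, f != 0 & (msize f).-1 = d]) /\
  forall f, J f -> f != 0 -> (d <= (msize f).-1)%N.

(* Equal to 0 by convention when J has no nonzero element. *)
Definition alpha (J : set R) : nat := xget 0%N [set d | least_degree J d].

End StarConfigurations.

(* Main.v *)
Require Import Defs.
From mathcomp Require Import all_boot all_order all_algebra.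
From mathcomp Require Import boolp classical_sets.
From mathcomp Require Import mpoly.
From mathcomp Require Import zify ring.

(** Write [l_S] for the ideal of the forms indexed by [S]. As the hyperplanes
    meet properly, any [N + 1] of the forms are linearly independent, hence are
    the variables of the polynomial ring after a linear change of coordinates.

    Everything rests on one fact, [star_symbolic_power_span]: the symbolic power
    [I^(m)] is spanned by the products [\prod_i l_i ^ a_i] it contains, and such
    a product belongs to it as soon as [\sum_(i in S) a_i >= m] for all
    [c]-subsets [S]. It is the case [A = set0], [B = setT], [b = 0] of
    [star_monomials_decomposition], which works modulo the forms of [A], with the
    hyperplanes of [B], and with the conditions relaxed by exponents [b]: the
    order along [S] need only be [m - \sum_(i in S) b_i]. One picks [j] in [B]
    with [b_j] minimal and restricts [h] to the hyperplane [l_j = 0]. There, the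
    conditions on the [c]-subsets containing [j] become conditions on
    [(c-1)]-subsets avoiding [j]; they are of the same type, so by induction on
    [c] the restriction is a combination of products of forms, and since [b_j] is
    minimal these products satisfy all the conditions already in the ambient
    space ([lift_star_monomials]). Subtracting them leaves a multiple of [l_j],
    and dividing by [l_j] amounts to increasing [b_j] by one
    ([power_mod_colon], proved in coordinates). The process stops when all the
    [b_j] are at least [m].

    The containments are then about exponents. Let [\prod_i l_i ^ a_i] be in
    [I^(q)] with [q > (m - 1) c], let [S] consist of [c] indices with the smallest
    exponents, and let [a_j] be the largest exponent in [S]. From
    [c a_j >= \sum_(i in S) a_i >= q] comes [a_j >= m], so the [m]-th power of the
    product [p] of [l_j] and of the forms outside [S] divides the given product.
    Now [p] is in [I], because its [s - c + 1] factors meet every [c]-subset, and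
    the exponents left on [S] sum to at least [q - m]. Hence
    [I^(q) <= M^(q-m) I^m]
    ([star_symbolic_power_containment]), which gives the first three parts with
    [q = m c], [m N], [m c - c + 1] and [m N - N + 1].

    For the last three parts, the same choice of [S] gives
    [c alpha(I^(t)) >= t s], while nearly constant exponents give
    [alpha(I^(m)) <= m + (s - c) k] for [k] the round-up of [m / c]. The
    inequalities follow because [c k <= m + c - 1]. *)

Set Implicit Arguments.
Unset Strict Implicit.
Unset Printing Implicit Defensive.

Import Order.TTheory GRing.Theory Num.Theory.
Local Open Scope classical_set_scope.
Local Open Scope ring_scope.

(** * Sums, products and powers of ideals *)

Section IdealOperations.
Variable R : comNzRingType.
Implicit Types (I J L A : set R) (n k : nat).

Definition ideal_add I J : set R :=
  [set x | exists y z, [/\ I y, J z & x = y + z]].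

Lemma ideal0 I : is_ideal I -> I 0.
Proof. by case. Qed.

Lemma idealD I x y : is_ideal I -> I x -> I y -> I (x + y).
Proof. by case=> _ + _; apply. Qed.

Lemma ideal_absorbl I a x : is_ideal I -> I x -> I (a * x).
Proof. by case=> _ _; apply. Qed.

Lemma ideal_absorbr I a x : is_ideal I -> I x -> I (x * a).
Proof. by rewrite mulrC; apply: ideal_absorbl. Qed.

Lemma idealB I x y : is_ideal I -> I x -> I y -> I (x - y).
Proof.
by move=> idI Ix Iy; rewrite -mulN1r; apply: idealD => //; apply: ideal_absorbl.
Qed.

Lemma ideal_sum I (T : Type) (r : seq T) (P : pred T) (F : T -> R) :
  is_ideal I -> (forall i, P i -> I (F i)) -> I (\sum_(i <- r | P i) F i).
Proof.
move=> idI IF; apply: big_ind => //; first exact: ideal0.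
by move=> x y; apply: idealD.
Qed.

Lemma is_ideal_setT : is_ideal (setT : set R).
Proof. by []. Qed.

Lemma is_ideal_span A : is_ideal (ideal_span A).
Proof.
split=> [|x y [n1 [a1 [b1 [Ab1 ->]]]] [n2 [a2 [b2 [Ab2 ->]]]]|c x].
- by exists 0%N, (fun=> 0), (fun=> 0); split=> [[]//|]; rewrite big_ord0.
- exists (n1 + n2)%N.
  exists (fun i => match split i with inl j => a1 j | inr j => a2 j end).
  exists (fun i => match split i with inl j => b1 j | inr j => b2 j end).
  split=> [i|]; first by case: (split i).
  rewrite big_split_ord; congr (_ + _); apply: eq_bigr => i _.
    by rewrite -[lshift _ _]/(unsplit (inl i)) unsplitK.
  by rewrite -[rshift _ _]/(unsplit (inr i)) unsplitK.
- move=> [n [a [b [Ab ->]]]]; exists n, (fun i => c * a i), b; split=> //.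
  by rewrite mulr_sumr; apply: eq_bigr => i _; rewrite mulrA.
Qed.

Lemma mem_ideal_span A : A `<=` ideal_span A.
Proof.
move=> x Ax; exists 1%N, (fun=> 1), (fun=> x); split=> //.
by rewrite big_ord1 mul1r.
Qed.

Lemma ideal_span_min A I : is_ideal I -> A `<=` I -> ideal_span A `<=` I.
Proof.
move=> idI AI _ [n [a [b [Ab ->]]]]; apply: ideal_sum => // i _.
by apply: ideal_absorbl => //; apply/AI/Ab.
Qed.

Lemma is_ideal_principal x : is_ideal [set y : R | exists r, y = r * x].
Proof.
split=> [|_ _ [r ->] [r' ->]|a _ [r ->]].
- by exists 0; rewrite mul0r.
- by exists (r + r'); rewrite mulrDl.
- by exists (a * r); rewrite mulrA.
Qed.

Lemma is_ideal_colon I y : is_ideal I -> is_ideal [set x | I (x * y)].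
Proof.
move=> idI; split=> [|x x' /= Ix Ix'|a x /= Ix]; rewrite /= ?mul0r.
- exact: ideal0.
- by rewrite mulrDl; apply: idealD.
- by rewrite -mulrA; apply: ideal_absorbl.
Qed.

Lemma is_ideal_mul I J : is_ideal (ideal_mul I J).
Proof. exact: is_ideal_span. Qed.

Lemma is_ideal_exp I n : is_ideal (ideal_exp I n).
Proof. by case: n => [|n]; [apply: is_ideal_setT | apply: is_ideal_mul]. Qed.

Lemma mem_ideal_mul I J x y : I x -> J y -> ideal_mul I J (x * y).
Proof. by move=> Ix Jy; apply: mem_ideal_span; exists x, y. Qed.

Lemma ideal_mul_min I J L : is_ideal L ->
  (forall x y, I x -> J y -> L (x * y)) -> ideal_mul I J `<=` L.
Proof.
by move=> idL IJL; apply: ideal_span_min => // _ [x [y [Ix Jy ->]]]; apply: IJL.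
Qed.

Lemma ideal_expS_min I L n : is_ideal L ->
  (forall x y, I x -> ideal_exp I n y -> L (x * y)) -> ideal_exp I n.+1 `<=` L.
Proof. exact: ideal_mul_min. Qed.

Lemma ideal_mul_subr I J : is_ideal J -> ideal_mul I J `<=` J.
Proof. by move=> idJ; apply: ideal_mul_min => // x y _; apply: ideal_absorbl. Qed.

Lemma ideal_exp1 I x : I x -> ideal_exp I 1 x.
Proof. by move=> Ix; rewrite -[x]mulr1; apply: mem_ideal_mul. Qed.

Lemma ideal_exp_decr I a b : (a <= b)%N -> ideal_exp I b `<=` ideal_exp I a.
Proof.
move=> /subnK <-; elim: (b - a)%N => [//|n IHn] x.
by rewrite addSn => /(ideal_mul_subr (is_ideal_exp _ _)); apply: IHn.
Qed.

Lemma ideal_exp_sub I n : is_ideal I -> (0 < n)%N -> ideal_exp I n `<=` I.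
Proof.
move=> idI n_gt0 x /(ideal_exp_decr n_gt0).
by apply: (@ideal_expS_min I I 0) => // y z Iy _; apply: ideal_absorbr.
Qed.

Lemma ideal_exp_mono I J n : I `<=` J -> ideal_exp I n `<=` ideal_exp J n.
Proof.
move=> IJ; elim: n => [//|n IHn]; apply: ideal_expS_min; first exact: is_ideal_exp.
by move=> x y /IJ Jx /IHn Jy; apply: mem_ideal_mul.
Qed.

Lemma ideal_expD I a b x y :
  ideal_exp I a x -> ideal_exp I b y -> ideal_exp I (a + b) (x * y).
Proof.
move=> Iax Iby; elim: a x Iax => [|a IHa] x.
  by move=> _; apply: ideal_absorbl => //; apply: is_ideal_exp.
apply: (@ideal_expS_min I [set z | ideal_exp I (a.+1 + b) (z * y)]).
  exact/is_ideal_colon/is_ideal_exp.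
by move=> u v Iu /IHa Iv; rewrite /= -mulrA; apply: mem_ideal_mul.
Qed.

Lemma ideal_expX I x n : I x -> ideal_exp I n (x ^+ n).
Proof.
move=> Ix; elim: n => [//|n IHn]; rewrite exprS; exact: mem_ideal_mul.
Qed.

Lemma ideal_exp_prod I (T : finType) (P : pred T) (x : T -> R) (a : T -> nat) :
  (forall i, P i -> I (x i)) ->
  ideal_exp I (\sum_(i | P i) a i) (\prod_(i | P i) x i ^+ a i).
Proof.
move=> Ix; apply: (big_rec2 (fun n y => ideal_exp I n y)) => // i n y Pi.
by apply: ideal_expD; apply/ideal_expX/Ix.
Qed.

Lemma is_ideal_add I J : is_ideal I -> is_ideal J -> is_ideal (ideal_add I J).
Proof.
move=> idI idJ; split.
- by exists 0, 0; rewrite addr0; split=> //; apply: ideal0.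
- move=> _ _ [y [z [Iy Jz ->]]] [y' [z' [Iy' Jz' ->]]].
  by exists (y + y'), (z + z'); rewrite addrACA; split=> //; apply: idealD.
- move=> a _ [y [z [Iy Jz ->]]].
  by exists (a * y), (a * z); rewrite mulrDr; split=> //; apply: ideal_absorbl.
Qed.

Lemma ideal_add_subl I J : is_ideal J -> I `<=` ideal_add I J.
Proof. by move=> idJ x Ix; exists x, 0; rewrite addr0; split=> //; apply: ideal0. Qed.

Lemma ideal_add_subr I J : is_ideal I -> J `<=` ideal_add I J.
Proof. by move=> idI x Jx; exists 0, x; rewrite add0r; split=> //; apply: ideal0. Qed.

Lemma ideal_add_min I J L :
  is_ideal L -> I `<=` L -> J `<=` L -> ideal_add I J `<=` L.
Proof.
by move=> idL IL JL _ [y [z [/IL Ly /JL Lz ->]]]; apply: idealD.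
Qed.

(** Modulo [J], the ideals [I] and [I + J] have the same powers. *)
Lemma ideal_exp_add I J n : is_ideal J ->
  ideal_exp (ideal_add I J) n `<=` ideal_add (ideal_exp I n) J.
Proof.
move=> idJ; elim: n => [|n IHn]; first exact: ideal_add_subl.
apply: ideal_expS_min.
  by apply: is_ideal_add => //; apply: is_ideal_mul.
move=> x y [u [v [Iu Jv ->]]] /IHn [p [q [Ip Jq ->]]].
exists (u * p), (u * q + v * (p + q)); split; first exact: mem_ideal_mul.
  by apply: idealD => //; [apply: ideal_absorbl | apply: ideal_absorbr].
by rewrite mulrDl mulrDr addrA.
Qed.

End IdealOperations.

Lemma is_ideal_preim (R R' : comNzRingType) (phi : {rmorphism R -> R'})
  (J : set R') : is_ideal J -> is_ideal [set x | J (phi x)].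
Proof.
move=> idJ; split=> [|x y /= Jx Jy|a x /= Jx] /=.
- by rewrite rmorph0; apply: ideal0.
- by rewrite rmorphD; apply: idealD.
- by rewrite rmorphM; apply: ideal_absorbl.
Qed.

(** * Ideals spanned by monomials *)

Section MonomialIdeals.
Variables (K : fieldType) (n : nat).
Implicit Types (g : {mpoly K[n]}) (P : pred 'I_n) (U V W : set 'X_{1..n}).

Definition supported_in U : set {mpoly K[n]} :=
  [set g | forall m, m \in msupp g -> U m].

Definition order_ge P k : set 'X_{1..n} :=
  [set m | (k <= \sum_(i | P i) m i)%N].

Lemma supported_inM U V W g h :
  (forall m m', U m -> V m' -> W (m + m')%MM) ->
  supported_in U g -> supported_in V h -> supported_in W (g * h).
Proof.
move=> UVW Ug Vh m /msuppM_le /allpairsP [[m1 m2]] /= [].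
move=> /Ug Um1 /Vh Vm2 ->; exact: UVW.
Qed.

Lemma is_ideal_supported U :
  (forall m m', U m -> U (m + m')%MM) -> is_ideal (supported_in U).
Proof.
move=> UD; split=> [|g h Ug Uh|a g Ug].
- by move=> m; rewrite -mpolyC0 msupp0.
- by move=> m /msuppD_le; rewrite mem_cat => /orP[/Ug|/Uh].
- by rewrite mulrC; apply: (@supported_inM U setT) => // m m' Um _; apply: UD.
Qed.

Lemma order_geD P a b m m' :
  order_ge P a m -> order_ge P b m' -> order_ge P (a + b) (m + m')%MM.
Proof.
rewrite /order_ge /= => am bm; under eq_bigr do rewrite mnmDE.
by rewrite big_split leq_add.
Qed.

Lemma order_geDr P a m m' : order_ge P a m -> order_ge P a (m + m')%MM.
Proof. by move=> am; rewrite -[a]addn0; apply: order_geD. Qed.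

(** The morphism [psi] allows the order to be measured after a change of
    coordinates. *)
Lemma supported_in_exp (R : comNzRingType) (psi : {rmorphism R -> {mpoly K[n]}})
    P (I : set R) k :
  (forall f, I f -> supported_in (order_ge P 1) (psi f)) ->
  forall f, ideal_exp I k f -> supported_in (order_ge P k) (psi f).
Proof.
move=> I1; elim: k => [//|k IHk]; apply: ideal_expS_min.
  apply: (is_ideal_preim psi); apply: is_ideal_supported => m m'.
  exact: order_geDr.
move=> x y /I1 Ix /IHk; rewrite /= rmorphM; apply: supported_inM Ix => m m'.
exact: order_geD.
Qed.

End MonomialIdeals.

(** * Linear forms in general position *)

Section GeneralPosition.
Variables (K : fieldType) (N s : nat) (l : 'I_s -> {mpoly K[N.+1]}).
Local Notation R := {mpoly K[N.+1]}.
Implicit Types (S A T : {set 'I_s}).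

Definition forms_at (sigma : 'I_N.+1 -> 'I_s) : N.+1.-tuple R :=
  [tuple l (sigma i) | i < N.+1].

(** Linear independence of any [N.+1] of the forms, in the form in which it is
    used: some [psi] turns them into the variables and is undone by substituting
    them back. *)
Definition general_position : Prop :=
  forall sigma : 'I_N.+1 -> 'I_s, injective sigma ->
  exists psi : {rmorphism R -> R},
    (forall i, psi (l (sigma i)) = 'X_i) /\
    cancel psi (comp_mpoly (forms_at sigma)).

Lemma linear_formE (f : R) :
  f \is 1.-homog -> f = \sum_(j < N.+1) f@_(U_(j)) *: 'X_j.
Proof.
move=> f1; apply/mpolyP=> m; rewrite raddf_sum /=.
under eq_bigr do rewrite mcoeffZ mcoeffX.
have [/mdeg1P [i /eqP ->]|m_neq1] := boolP (mdeg m == 1%N).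
  rewrite (bigD1 i) //= eqxx mulr1 big1 ?addr0 // => j ji.
  case: eqP => [/(congr1 (fun m : 'X_{1..N.+1} => m i))|_]; last by rewrite mulr0.
  by rewrite !mnm1E eqxx (negbTE ji).
rewrite big1 ?(dhomog_nemf_coeff f1 m_neq1) // => j _.
by case: (U_(j)%MM =P m) m_neq1 => [<-|]; rewrite ?mdeg1 ?mulr0.
Qed.

Lemma meval_linear_form (f : R) (x : 'rV[K]_N.+1) : f \is 1.-homog ->
  f.@[fun i => x 0 i] = \sum_(j < N.+1) f@_(U_(j)) * x 0 j.
Proof.
move=> /linear_formE f1; rewrite {1}f1 raddf_sum /=; apply: eq_bigr => j _.
by rewrite mevalZ mevalXU.
Qed.

(** A point at which [N + 1] of the forms vanish lies in the intersection of
    [N + 1] hyperplanes, which is zero by hypothesis: the matrix of coefficients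
    of these forms is invertible. *)
Lemma meet_properly_general_position (H : 'I_s -> {vspace 'rV[K]_N.+1}) :
  (forall i, defining_form (l i) (H i)) -> meet_properly H ->
  general_position.
Proof.
move=> hl hproper sigma sigma_inj.
pose L : 'M[K]_N.+1 := \matrix_(j, i) (l (sigma i))@_(U_(j)).
have Lunit : L \in unitmx.
  rewrite -row_free_unit; apply/inj_row_free => x xL0.
  have: x \in (\bigcap_(i in [set sigma i | i : 'I_N.+1]) H i)%VS.
    apply/subv_bigcapP => _ /imsetP[i _ ->]; apply/(hl (sigma i)).2.
    rewrite meval_linear_form; last by case: (hl (sigma i)).
    have /matrixP/(_ 0 i) := xL0; rewrite !mxE => xLi.
    rewrite -[RHS]xLi; by apply: eq_bigr => j _; rewrite mxE mulrC.
  case: (hproper [set sigma i | i : 'I_N.+1]) => [->|]; first by rewrite memv0 => /eqP.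
  rewrite card_imset // card_ord => /eqP; rewrite -[X in _ == X]add0n eqn_add2r.
  by rewrite dimv_eq0 => /eqP ->; rewrite memv0 => /eqP.
pose lq : N.+1.-tuple R := [tuple \sum_(k < N.+1) (invmx L) k j *: 'X_k | j < N.+1].
have sum_mx (A B : 'M[K]_N.+1) i (y : 'I_N.+1 -> R) : A *m B = 1%:M ->
    \sum_j B j i *: (\sum_k A k j *: y k) = y i.
  move=> AB1; under eq_bigr do rewrite scaler_sumr.
  rewrite exchange_big /= (bigD1 i) //= [X in _ + X]big1 ?addr0 => [|k ki].
    transitivity ((A *m B) i i *: y i); last by rewrite AB1 !mxE eqxx scale1r.
    by rewrite mxE scaler_suml; apply: eq_bigr => j _; rewrite scalerA mulrC.
  transitivity ((A *m B) k i *: y k).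
    by rewrite mxE scaler_suml; apply: eq_bigr => j _; rewrite scalerA mulrC.
  by rewrite AB1 !mxE (negbTE ki) scale0r.
exists (comp_mpoly lq); split=> [i|f].
  rewrite [l _]linear_formE; last by case: (hl (sigma i)).
  rewrite raddf_sum -[RHS](sum_mx _ _ i (fun k => 'X_k) (mulVmx Lunit)).
  apply: eq_bigr => j _; rewrite /= comp_mpolyZ comp_mpolyXU -tnth_nth tnth_mktuple.
  by rewrite mxE.
rewrite /= [f \mPo _]comp_mpolyEX raddf_sum [RHS]mpolyE; apply: eq_bigr => m _.
rewrite /= comp_mpolyZ comp_mpolyX rmorph_prod mpolyXE_id; congr (_ *: _).
apply: eq_bigr => i _; rewrite rmorphXn tnth_mktuple raddf_sum /=; congr (_ ^+ _).
rewrite -[RHS](sum_mx _ _ i (fun k => 'X_k) (mulmxV Lunit)).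
apply: eq_bigr => j _; rewrite comp_mpolyZ comp_mpolyXU -tnth_nth tnth_mktuple.
rewrite [l _]linear_formE; last by case: (hl (sigma j)).
by congr (_ *: _); apply: eq_bigr => k _; rewrite mxE.
Qed.

Lemma mem_forms S j : j \in S -> forms_ideal l S (l j).
Proof. by move=> Sj; apply: mem_ideal_span; exists j. Qed.

Lemma is_ideal_forms S : is_ideal (forms_ideal l S).
Proof. exact: is_ideal_span. Qed.

Lemma forms_ideal_min S I :
  is_ideal I -> (forall j, j \in S -> I (l j)) -> forms_ideal l S `<=` I.
Proof. by move=> idI SI; apply: ideal_span_min => // _ [j Sj ->]; apply: SI. Qed.

Lemma forms_ideal_mono S T : S \subset T -> forms_ideal l S `<=` forms_ideal l T.
Proof.
move=> /fintype.subsetP ST; apply: forms_ideal_min; first exact: is_ideal_forms.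
by move=> j /ST; apply: mem_forms.
Qed.

Lemma forms_ideal0 : forms_ideal l finset.set0 `<=` [set 0].
Proof.
apply: forms_ideal_min => [|j]; last by rewrite inE.
by split=> [//|x y -> ->|a x ->] /=; rewrite ?addr0 ?mulr0.
Qed.

(** The ideal [(l_S)^k + (l_A)]; it plays the part of [(l_S)^k] in the quotient
    by the forms indexed by [A]. *)
Definition power_mod S A k : set R :=
  ideal_add (ideal_exp (forms_ideal l S) k) (forms_ideal l A).

Lemma is_ideal_power_mod S A k : is_ideal (power_mod S A k).
Proof. by apply: is_ideal_add; [apply: is_ideal_exp | apply: is_ideal_forms]. Qed.

Lemma exp_sub_power_mod S A k x :
  ideal_exp (forms_ideal l S) k x -> power_mod S A k x.
Proof. by move=> ?; apply: ideal_add_subl => //; apply: is_ideal_forms. Qed.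

Lemma forms_sub_power_mod S A k x : forms_ideal l A x -> power_mod S A k x.
Proof. by move=> ?; apply: ideal_add_subr => //; apply: is_ideal_exp. Qed.

Lemma forms_prod S T (a : 'I_s -> nat) : S \subset T ->
  ideal_exp (forms_ideal l S) (\sum_(i in S) a i) (\prod_(i in T) l i ^+ a i).
Proof.
move=> /fintype.subsetP ST; rewrite [X in ideal_exp _ _ X](bigID (mem S)) /=.
apply: ideal_absorbr.
  exact: is_ideal_exp.
rewrite [X in ideal_exp _ _ X](eq_bigl (mem S)); last first.
  by move=> i /=; case: (boolP (i \in S)) => [/ST ->|]; rewrite ?andbF // => /negbTE.
by apply: ideal_exp_prod => i; apply: mem_forms.
Qed.

Lemma exists_injective_cover T : (#|T| <= N.+1)%N -> (N.+1 <= s)%N ->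
  exists2 sigma : 'I_N.+1 -> 'I_s, injective sigma &
    forall j, j \in T -> exists i, j = sigma i.
Proof.
move=> leT leN; have x0 : 'I_s := Ordinal leN.
pose r := take N.+1 (enum T ++ enum (~: T)).
have szr : size r = N.+1.
  by rewrite size_takel // size_cat -!cardE cardsC card_ord.
have r_uniq : uniq r.
  apply: take_uniq; rewrite cat_uniq !enum_uniq andbT /=.
  by apply/hasPn => i; rewrite !mem_enum inE.
exists (fun i => nth x0 r i) => [i j /eqP|j Tj].
  by rewrite nth_uniq ?szr // => /eqP/val_inj.
have rj : j \in r.
  by rewrite /r take_cat -cardE ltnNge leT /= mem_cat mem_enum Tj.
have ltj : (index j r < N.+1)%N by rewrite -szr index_mem.
by exists (Ordinal ltj); rewrite nth_index.
Qed.

Section Coordinates.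
Variables (sigma : 'I_N.+1 -> 'I_s) (psi : {rmorphism R -> R}).
Variables (S A : {set 'I_s}).
Hypothesis psi_form : forall i, psi (l (sigma i)) = 'X_i.
Hypothesis psiK : cancel psi (comp_mpoly (forms_at sigma)).
Hypothesis S_cover : forall j, j \in S -> exists i, j = sigma i.
Hypothesis A_cover : forall j, j \in A -> exists i, j = sigma i.

Let inS : pred 'I_N.+1 := [pred i | sigma i \in S].

Definition power_mod_monomials k : set 'X_{1..N.+1} :=
  [set m : 'X_{1..N.+1} | (exists2 i, sigma i \in A & 0 < m i)%N \/ order_ge inS k m].

Lemma is_ideal_power_mod_monomials k :
  is_ideal (@supported_in K _ (power_mod_monomials k)).
Proof.
apply: is_ideal_supported => m m' [[i Ai mi]|mk]; [left | right].
  by exists i => //; rewrite mnmDE ltn_addr.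
exact: order_geDr.
Qed.

(** In the coordinates [psi] the ideal is spanned by monomials, so membership is
    decided monomial by monomial. *)
Lemma power_modP k f :
  power_mod S A k f <-> supported_in (power_mod_monomials k) (psi f).
Proof.
split=> [|psif].
  have idk := is_ideal_preim psi (is_ideal_power_mod_monomials k).
  move: f; apply: (ideal_add_min idk) => [f Sf|].
    suff: supported_in (order_ge inS k) (psi f) by move=> kf m /kf ?; right.
    apply: supported_in_exp Sf; apply: forms_ideal_min => [|j /[dup] Sj].
      apply: (is_ideal_preim psi); apply: is_ideal_supported => m m'.
      exact: order_geDr.
    move=> /S_cover [i jE] /=; rewrite jE psi_form => m.
    rewrite msuppX inE => /eqP ->; rewrite /order_ge /= (bigD1 i) ?mnm1E ?eqxx //.
    by rewrite /inS /= -jE.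
  apply: forms_ideal_min => // j /[dup] Aj /A_cover [i jE] /=.
  rewrite jE psi_form => m; rewrite msuppX inE => /eqP ->; left.
  by exists i; rewrite -?jE // mnm1E eqxx.
rewrite -[f]psiK comp_mpolyE; rewrite big_seq; apply: ideal_sum => [|m /psif].
  exact: is_ideal_power_mod.
move=> mk; rewrite -mul_mpolyC; apply: ideal_absorbl; first exact: is_ideal_power_mod.
under eq_bigr do rewrite tnth_mktuple.
case: mk => [[i Ai mi]|mk].
  rewrite (bigD1 i) //=; apply: ideal_absorbr; first exact: is_ideal_power_mod.
  apply: forms_sub_power_mod; rewrite -(prednK mi) exprSr.
  by apply: ideal_absorbl; [apply: is_ideal_forms | apply: mem_forms].
apply/exp_sub_power_mod/(ideal_exp_decr mk).
rewrite [X in ideal_exp _ _ X](bigID inS) /=.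
apply: ideal_absorbr; first exact: is_ideal_exp.
by apply: ideal_exp_prod => i; apply: mem_forms.
Qed.

End Coordinates.

End GeneralPosition.

(** * Generators of symbolic powers *)

Section StandardMonomials.
Variables (K : fieldType) (N s : nat) (l : 'I_s -> {mpoly K[N.+1]}).
Local Notation R := {mpoly K[N.+1]}.
Implicit Types (S A B : {set 'I_s}) (a b : 'I_s -> nat).
Hypothesis leNs : (N.+1 <= s)%N.
Hypothesis l_general : general_position l.

Lemma sum_eq_mem S j : (\sum_(i in S) (i == j) = (j \in S))%N.
Proof.
have [Sj|/negP Sj] := boolP (j \in S).
  by rewrite (bigD1 j) //= eqxx big1 // => i /andP[_ /negbTE ->].
by rewrite big1 // => i Si; case: eqP => // ij; rewrite -ij in Sj.
Qed.

(** In coordinates containing the forms indexed by [S], [A] and [j], dividing by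
    [l j] lowers the order along [S] by one when [j] is in [S], and is harmless
    modulo a monomial ideal in the other variables when it is not. *)
Lemma power_mod_colon S A j k r :
  (#|j |: (S :|: A)| <= N.+1)%N -> j \notin A ->
  power_mod l S A k (r * l j) -> power_mod l S A (k - (j \in S)) r.
Proof.
move=> cardT Aj.
have [sigma sigma_inj cover] := exists_injective_cover cardT leNs.
have [psi [psi_form psiK]] := l_general sigma_inj.
have Scov i : i \in S -> exists i0, i = sigma i0.
  by move=> Si; apply: cover; rewrite !inE Si orbT.
have Acov i : i \in A -> exists i0, i = sigma i0.
  by move=> Ai; apply: cover; rewrite !inE Ai !orbT.
move=> /(power_modP psi_form psiK Scov Acov) rlj.
apply/(power_modP psi_form psiK Scov Acov) => m rm.
have [i0 jE] : exists i0, j = sigma i0 by apply: cover; rewrite !inE eqxx.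
have /rlj : (U_(i0) + m)%MM \in msupp (psi (r * l j)).
  by rewrite rmorphM jE psi_form mcoeff_msupp mcoeffMX -mcoeff_msupp.
case=> [[i Ai]|].
  rewrite mnmDE mnm1E; case: eqP => [i0i|_ mi]; last by left; exists i.
  by rewrite jE i0i Ai in Aj.
move=> mk; right; move: mk; rewrite /order_ge /=; under eq_bigr do rewrite mnmDE mnm1E.
rewrite big_split /= leq_subLR; congr (_ <= _ + _)%N.
have [Sj|/negP Sj] := boolP (j \in S).
  rewrite (bigD1 i0) /= -?jE // eqxx big1 // => i /andP[_].
  by rewrite eq_sym => /negbTE ->.
by rewrite big1 // => i Si; case: eqP => // ij; rewrite jE ij in Sj.
Qed.

(** The exponents [b] are those of a factor already divided out, whose order
    along [S] still counts towards [m]. *)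
Definition star_monomials B c m b : set R :=
  [set f | exists2 a : 'I_s -> nat,
     forall S, S \subset B -> #|S| = c ->
       (m <= \sum_(i in S) a i + \sum_(i in S) b i)%N
     & f = \prod_(i in B) l i ^+ a i].

Lemma star_monomials_power_mod B c m b A S : S \subset B -> #|S| = c ->
  ideal_span (star_monomials B c m b) `<=` power_mod l S A (m - \sum_(i in S) b i).
Proof.
move=> SB Sc; apply: ideal_span_min; first exact: is_ideal_power_mod.
move=> _ [a am ->].
have le_ma : (m - \sum_(i in S) b i <= \sum_(i in S) a i)%N.
  by rewrite leq_subLR addnC am.
exact/exp_sub_power_mod/(ideal_exp_decr le_ma)/(forms_prod l a SB).
Qed.

(** A product of forms avoiding [j] that is admissible on the hyperplane [H_j]
    is admissible in the ambient space: as [b j] is minimal, exchanging [j] for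
    another index can only weaken the condition on a [c.+1]-subset. *)
Lemma lift_star_monomials B c m b j : j \in B -> (forall i, i \in B -> b j <= b i)%N ->
  star_monomials (B :\ j) c (m - b j) b `<=` star_monomials B c.+1 m b.
Proof.
move=> Bj jmin _ [a am ->]; exists (fun i => if i == j then 0%N else a i).
  move=> S SB Sc.
  have [i [Si bji jS]] : exists i, [/\ i \in S, (b j <= b i)%N & j \notin S :\ i].
    have [Sj|Sj] := boolP (j \in S); first by exists j; rewrite leqnn !inE eqxx.
    have /card_gt0P [i Si] : (0 < #|S|)%N by rewrite Sc.
    by exists i; rewrite Si jmin ?(fintype.subsetP SB) // !inE (negbTE Sj) andbF.
  have SiB : S :\ i \subset B :\ j.
    rewrite finset.subsetD1 jS andbT.
    apply: fintype.subset_trans SB; exact: finset.subD1set.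
  have /(am _ SiB) : #|S :\ i| = c by move: Sc; rewrite (cardsD1 i) Si => -[].
  rewrite leq_subLR ![(\sum_(_ in S) _)%N](big_setD1 i) //=.
  have -> : (\sum_(i0 in S :\ i) (if i0 == j then 0 else a i0) =
             \sum_(i0 in S :\ i) a i0)%N.
    by apply: eq_bigr => i0; case: eqP => // -> Si0; rewrite Si0 in jS.
  move: bji (\sum_(i0 in S :\ i) a i0)%N (\sum_(i0 in S :\ i) b i0)%N => bji x y.
  by case: (i == j); lia.
rewrite [RHS](big_setD1 j) //= eqxx mul1r; apply: eq_bigr => i.
by rewrite !inE => /andP[/negbTE ->].
Qed.

(** One more factor [l j] makes up for lowering [b j] by one. *)
Lemma mul_star_monomials B c m b j f : j \in B ->
  ideal_span (star_monomials B c m (fun i => b i + (i == j))%N) f ->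
  ideal_span (star_monomials B c m b) (f * l j).
Proof.
move=> Bj; move: f; apply: ideal_span_min.
  exact/is_ideal_colon/is_ideal_span.
move=> _ [a am ->]; apply: mem_ideal_span; exists (fun i => a i + (i == j))%N.
  move=> S SB Sc; have := am S SB Sc; rewrite !big_split /=; lia.
under [RHS]eq_bigr do rewrite exprD.
rewrite big_split /=; congr (_ * _); rewrite (big_setD1 j) //= eqxx expr1.
by rewrite big1 ?mulr1 // => i; rewrite !inE => /andP[/negbTE ->].
Qed.

(** Local membership along every [c]-subset of [B], relaxed by [b] and taken
    modulo the forms of [A], implies membership in the span of the products. The
    outer induction on [c] trades an element of [B] for an element of [A]; the
    inner one increases the smallest of the exponents [b]. The bound
    [#|A| + c <= N] leaves room for one more independent form, as needed to
    divide by [l j]. *)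
Lemma star_monomials_decomposition c A B m b h :
  (forall i, i \in B -> i \notin A) -> (#|A| + c <= N)%N ->
  (forall S, S \subset B -> #|S| = c ->
     power_mod l S A (m - \sum_(i in S) b i) h) ->
  ideal_add (ideal_span (star_monomials B c m b)) (forms_ideal l A) h.
Proof.
have idD B0 c0 m0 b0 A0 : is_ideal
    (ideal_add (ideal_span (star_monomials B0 c0 m0 b0)) (forms_ideal l A0)).
  by apply: is_ideal_add; [apply: is_ideal_span | apply: is_ideal_forms].
have trivial_case B0 c0 m0 b0 A0 f :
    (forall S, S \subset B0 -> #|S| = c0 -> m0 <= \sum_(i in S) b0 i)%N ->
    ideal_add (ideal_span (star_monomials B0 c0 m0 b0)) (forms_ideal l A0) f.
  move=> bm; apply: ideal_add_subl; first exact: is_ideal_forms.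
  rewrite -[f]mulr1; apply: ideal_absorbl; first exact: is_ideal_span.
  apply: mem_ideal_span; exists (fun=> 0%N) => [S SB Sc|].
    by rewrite big1 // add0n bm.
  by rewrite big1.
elim: c A B m b h => [|c IHc] A B m b h disAB leAN hS.
  (* The only condition concerns the empty subset, whose ideal is zero. *)
  case: (posnP m) => [->|m_gt0]; first by apply: trivial_case.
  have := hS finset.set0 (finset.sub0set _) (cards0 _); rewrite big_set0 subn0.
  apply: ideal_add_min => // f; last by apply/ideal_add_subr/is_ideal_span.
  move=> /(ideal_exp_sub (is_ideal_forms _ _) m_gt0)/forms_ideal0 ->.
  exact: ideal0.
have [n] := ubnP (\sum_(i in B) (m - b i))%N.
elim: n b h hS => // n IHn b h hS; rewrite ltnS => len.
case: (pickP [pred i in B | b i < m]%N) => [i1 /andP[Bi1 bi1]|b_ge]; last first.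
  apply: trivial_case => S SB Sc.
  have /card_gt0P [i Si] : (0 < #|S|)%N by rewrite Sc.
  have := b_ge i; rewrite /= (fintype.subsetP SB) //= ltnNge => /negbFE mb.
  by rewrite (big_setD1 i) //= (leq_trans mb) ?leq_addr.
have [j Bj jmin] : exists2 j, j \in B & forall i, i \in B -> (b j <= b i)%N.
  by case: (arg_minnP b Bi1) => j; exists j.
have bj : (b j < m)%N by apply: leq_ltn_trans (jmin _ Bi1) bi1.
have Aj : j \notin A := disAB _ Bj.
(* Restricting to the hyperplane of [l j] lowers [c] by one. *)
have {IHc}: ideal_add (ideal_span (star_monomials (B :\ j) c (m - b j) b))
    (forms_ideal l (j |: A)) h.
  apply: IHc => [||T TB Tc].
  - by move=> i; rewrite !inE => /andP[/negbTE -> /disAB].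
  - by rewrite finset.cardsU1 Aj; lia.
  have jT : j \notin T.
    by apply/negP => /(fintype.subsetP TB); rewrite !inE eqxx.
  have SB : j |: T \subset B.
    by rewrite finset.subUset finset.sub1set Bj
      (fintype.subset_trans TB) ?finset.subD1set.
  have := hS _ SB; rewrite finset.cardsU1 jT Tc => /(_ erefl).
  rewrite big_setU1 //= subnDA; apply: ideal_add_min => [|f|f].
  - exact: is_ideal_power_mod.
  - move=> fS; apply: ideal_exp_add; first exact: is_ideal_forms.
    apply: ideal_exp_mono fS; apply: forms_ideal_min.
      by apply: is_ideal_add; apply: is_ideal_forms.
    move=> i /finset.setU1P[->|Ti].
      by apply/ideal_add_subr; [apply: is_ideal_forms|apply/mem_forms/finset.setU11].
    by apply/ideal_add_subl; [apply: is_ideal_forms|apply: mem_forms].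
  - move=> /(forms_ideal_mono (finset.subsetUr [set j] A)).
    exact: forms_sub_power_mod.
(* The restricted decomposition lifts up to a multiple of [l j]. *)
move=> [g [w [gmon wA hE]]].
have [v [_ [vA [r ->] wE]]] :
    ideal_add (forms_ideal l A) [set y : R | exists r, y = r * l j] w.
  apply: forms_ideal_min wA; first apply: is_ideal_add.
  - exact: is_ideal_forms.
  - exact: is_ideal_principal.
  move=> i /finset.setU1P[->|Ai]; last first.
    by apply: ideal_add_subl; [apply: is_ideal_principal|apply: mem_forms].
  by apply: ideal_add_subr; [apply: is_ideal_forms|exists 1; rewrite mul1r].
have {}gmon : ideal_span (star_monomials B c.+1 m b) g.
  move: g gmon {hE}; apply: ideal_span_min; first exact: is_ideal_span.
  by move=> f /(lift_star_monomials Bj jmin)/mem_ideal_span.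
(* The cofactor [r] satisfies the hypotheses with [b j] increased by one. *)
have rD : ideal_add
   (ideal_span (star_monomials B c.+1 m (fun i => b i + (i == j))%N))
   (forms_ideal l A) r.
  apply: IHn => [S SB Sc|].
    rewrite big_split /= sum_eq_mem subnDA; apply: power_mod_colon => //.
      have [+ _] := leq_card_setU S A; rewrite finset.cardsU1; lia.
    have -> : r * l j = h - g - v by rewrite hE wE; ring.
    have idS := is_ideal_power_mod l S A (m - \sum_(i in S) b i).
    apply: idealB => //; last exact: forms_sub_power_mod.
    by apply: idealB => //; [apply: hS | apply: star_monomials_power_mod gmon].
  apply: leq_trans len; rewrite (big_setD1 j) //= [in leqRHS](big_setD1 j) //=.
  by rewrite eqxx -addSn; apply: leq_add; [lia | apply: leq_sum => i _; lia].
have -> : h = g + v + r * l j by rewrite hE wE; ring.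
apply: idealD => //; first by exists g, v.
case: rD => [p [q [pmon qA ->]]]; rewrite mulrDl.
exists (p * l j), (q * l j); split=> //; first exact: mul_star_monomials.
by apply: ideal_absorbr => //; apply: is_ideal_forms.
Qed.

End StandardMonomials.

(** * Containments of symbolic powers in ordinary powers *)

Lemma smallest_values (T : finType) (a : T -> nat) c : (c <= #|T|)%N ->
  exists2 S : {set T}, #|S| = c &
    forall i k, i \in S -> k \notin S -> (a i <= a k)%N.
Proof.
elim: c => [_|c IHc ltc].
  by exists finset.set0 => [|i k]; rewrite ?cards0 ?inE.
have [S Sc Smin] := IHc (ltnW ltc).
have /card_gt0P [k0 Sk0] : (0 < #|~: S|)%N by have := cardsC S; lia.
rewrite inE in Sk0.
have [k /= Sk kmin] := @arg_minnP _ k0 [pred k | k \notin S] a Sk0.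
exists (k |: S) => [|i k']; first by rewrite finset.cardsU1 /= Sk Sc.
rewrite !inE negb_or => /orP[/eqP -> /andP[_ /kmin]|Si /andP[_ Sk']] //.
exact: Smin.
Qed.

Section Containments.
Variables (K : fieldType) (N s : nat) (l : 'I_s -> {mpoly K[N.+1]}).
Local Notation R := {mpoly K[N.+1]}.
Implicit Types (S : {set 'I_s}) (a : 'I_s -> nat).
Hypothesis leNs : (N.+1 <= s)%N.
Hypothesis l_linear : forall i, l i \is 1.-homog.
Hypothesis l_general : general_position l.

Definition star_exponent c m a : Prop :=
  forall S, #|S| = c -> (m <= \sum_(i in S) a i)%N.

Lemma mem_star_symbolic_power c m a : star_exponent c m a ->
  star_symbolic_power l c m (\prod_i l i ^+ a i).
Proof.
move=> am S /am leam; rewrite -(eq_bigl _ _ (@finset.in_setT _)).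
by apply/(ideal_exp_decr leam)/forms_prod/finset.subsetT.
Qed.

Lemma star_symbolic_power_span c m : (c <= N)%N ->
  star_symbolic_power l c m
    `<=` ideal_span [set f | exists2 a, star_exponent c m a
                                      & f = \prod_i l i ^+ a i].
Proof.
move=> lecN h hc.
have hS S : S \subset finset.setT -> #|S| = c ->
    power_mod l S finset.set0 (m - \sum_(i in S) 0)%N h.
  by move=> _ Sc; rewrite big1 // subn0; apply/exp_sub_power_mod/hc.
have := star_monomials_decomposition leNs l_general _ _ hS.
rewrite cards0 => /(_ _ lecN) [|f [z [fmon /forms_ideal0 -> ->]]].
  by move=> i _; rewrite inE.
rewrite addr0; move: f fmon; apply: ideal_span_min; first exact: is_ideal_span.
move=> _ [a am ->]; apply: mem_ideal_span; exists a.
  move=> S Sc; have := am S (finset.subsetT _) Sc.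
  by rewrite [X in (_ + X)%N]big1 // addn0.
by apply: eq_bigl => i; rewrite inE.
Qed.

(** The largest of the [c] smallest exponents is at least their average, which
    is at least [m / c]. *)
Lemma star_exponent_threshold c m a : (0 < c <= N)%N -> star_exponent c m a ->
  exists S j, [/\ #|S| = c, j \in S, (m <= \sum_(i in S) a i <= c * a j)%N
                & forall i, i \notin S -> (a j <= a i)%N].
Proof.
move=> /andP[c_gt0 lecN] am.
have [|S Sc Smin] := @smallest_values _ a c; first by rewrite card_ord; lia.
have /card_gt0P [j0 Sj0] : (0 < #|S|)%N by rewrite Sc.
have [j /= Sj jmax] := @arg_maxnP _ j0 (mem S) a Sj0.
exists S, j; split=> //; last by move=> i; apply: Smin.
rewrite am //= -Sc -sum_nat_const; exact: leq_sum.
Qed.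

Lemma form_irrelevant i : irrelevant_ideal (l i).
Proof.
rewrite (linear_formE (l_linear i)); apply: ideal_sum => [|j _].
  exact: is_ideal_span.
rewrite -mul_mpolyC; apply: ideal_absorbl; first exact: is_ideal_span.
by apply: mem_ideal_span; exists j.
Qed.

(** One containment covers the first three parts of the theorem: it needs [q]
    only to be large enough for the [c]-th smallest exponent of a generator to be
    at least [m]. *)
Lemma star_symbolic_power_containment c m q : (0 < c <= N)%N ->
  (m.-1 * c < q)%N ->
  star_symbolic_power l c q
    `<=` ideal_mul (ideal_exp (@irrelevant_ideal K N) (q - m))
                   (ideal_exp (star_ideal l c) m).
Proof.
move=> c_bounds ltq; have /andP[c_gt0 lecN] := c_bounds.
move=> f /(star_symbolic_power_span lecN); move: f.
apply: ideal_span_min; first exact: is_ideal_mul.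
move=> _ [a aq ->].
have [S [j [Sc Sj /andP[qS Sja] jmin]]] := star_exponent_threshold c_bounds aq.
have mj : (m <= a j)%N.
  rewrite leqNgt; apply/negP => ajm.
  have : (c * a j <= c * m.-1)%N by rewrite leq_mul2l; apply/orP; right; lia.
  by rewrite [(c * m.-1)%N]mulnC; lia.
(* Only [c - 1] indices lie outside [P], so [P] meets every [c]-subset. *)
pose P := j |: ~: S.
have aP i : i \in P -> (m <= a i)%N.
  by rewrite !inE => /orP[/eqP ->|/jmin] //; apply: leq_trans.
have -> : \prod_i l i ^+ a i =
    (\prod_i l i ^+ (a i - m * (i \in P))) * (\prod_(i in P) l i) ^+ m.
  rewrite -prodrXl [X in _ = _ * X]big_mkcond -big_split; apply: eq_bigr => i _ /=.
  case: ifP => [/aP mi|_]; last by rewrite muln0 subn0 mulr1.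
  by rewrite muln1 -exprD subnK.
apply: mem_ideal_mul.
  suff le_deg : (q - m <= \sum_i (a i - m * (i \in P)))%N.
    by apply/(ideal_exp_decr le_deg)/ideal_exp_prod => i _; apply: form_irrelevant.
  rewrite (bigID (mem S)) /= (leq_trans _ (leq_addr _ _)) //.
  rewrite (big_setD1 j) //= in qS; rewrite (big_setD1 j) //= !inE eqxx muln1.
  rewrite (eq_bigr a); first by lia.
  by move=> i; rewrite !inE => /andP[/negbTE -> ->]; rewrite muln0 subn0.
apply: ideal_expX => S' S'c.
have [i S'i Pi] : exists2 i, i \in S' & i \in P.
  apply/exists_inP/contraT => /exists_inPn noP.
  have /subset_leq_card : S' \subset S :\ j.
    apply/fintype.subsetP => i /noP; rewrite !inE negb_or negbK => /andP[-> ->] //.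
  by rewrite S'c; move: Sc; rewrite (cardsD1 j) Sj; lia.
rewrite (bigD1 i) //=; apply: ideal_absorbr; first exact: is_ideal_forms.
exact: mem_forms.
Qed.

End Containments.

(** * Initial degrees of symbolic powers *)

Section InitialDegree.
Variables (K : fieldType) (N s : nat) (l : 'I_s -> {mpoly K[N.+1]}).
Local Notation R := {mpoly K[N.+1]}.
Implicit Types (S : {set 'I_s}) (a : 'I_s -> nat).
Hypothesis leNs : (N.+1 <= s)%N.
Hypothesis l_linear : forall i, l i \is 1.-homog.
Hypothesis l_general : general_position l.

(** The default value in the definition of [alpha] is not reached as soon as [J]
    has a nonzero element. *)
Lemma alphaP (J : set R) f : J f -> f != 0 -> least_degree J (alpha J).
Proof.
move=> Jf f_neq0; apply: xgetPex => /=.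
pose D d := `[< exists f : R, [/\ J f, f != 0 & (msize f).-1 = d] >].
have exD : exists d, D d by exists (msize f).-1; apply/asboolP; exists f.
case: (ex_minnP exD) => d /asboolP Dd dmin; exists d; split=> // g Jg g_neq0.
by apply: dmin; apply/asboolP; exists g.
Qed.

Lemma form_neq0 i : l i != 0.
Proof.
have [|sigma sigma_inj cover] := @exists_injective_cover N s [set i] _ leNs.
  by rewrite cards1.
have [psi [psi_form _]] := l_general sigma_inj.
have [j ->] : exists j, i = sigma j by apply: cover; rewrite inE.
apply/eqP => l0; have := psi_form j; rewrite l0 rmorph0 => X0.
by have := msizeX K U_(j)%MM; rewrite -X0 msize0.
Qed.

Lemma form_prod_neq0 a : \prod_i l i ^+ a i != 0.
Proof. by apply/prodf_neq0 => i _; rewrite expf_neq0 ?form_neq0. Qed.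

Lemma form_prod_degree a : (msize (\prod_i l i ^+ a i)).-1 = (\sum_i a i)%N.
Proof.
have homP : \prod_i l i ^+ a i \is (\sum_i a i)%N.-homog.
  apply: (big_rec2 (fun (d : nat) (p : R) => p \is d.-homog)) => [|i d p _ pd].
    exact: dhomog1.
  apply: dhomogM pd; rewrite -[X in X.-homog]mul1n; exact: dhomogMn.
exact: (dhomog_uniq (form_prod_neq0 a) (dhomog_msize homP) homP).
Qed.

(** The exponents outside [S] are at least the average of those in [S]. *)
Lemma star_exponent_degree c t a : (0 < c <= N)%N -> star_exponent c t a ->
  (t * s <= c * \sum_i a i)%N.
Proof.
move=> c_bounds at_; have /andP[c_gt0 lecN] := c_bounds.
have [S [j [Sc Sj /andP[tS Sja] jmin]]] := star_exponent_threshold leNs c_bounds at_.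
have cS : #|~: S| = (s - c)%N by have := cardsC S; rewrite Sc card_ord; lia.
have rest : ((s - c) * a j <= \sum_(i | i \notin S) a i)%N.
  have -> : (\sum_(i | i \notin S) a i = \sum_(i in ~: S) a i)%N.
    by apply: eq_bigl => i; rewrite finset.in_setC.
  rewrite -cS -sum_nat_const; apply: leq_sum => i.
  by rewrite finset.in_setC; apply: jmin.
rewrite (bigID (mem S)) /=.
move: (\sum_(i in S) a i)%N (\sum_(i | i \notin S) a i)%N tS Sja rest.
move=> x y tx xc yc; have [d sE] : exists d, s = (c + d)%N by exists (s - c)%N; lia.
move: yc; rewrite sE addKn => yc; nia.
Qed.

(** The monomials whose degree satisfies the bound span an ideal, so the bound
    passes from the generators to all the elements. *)
Lemma star_symbolic_power_degree c t f : (0 < c <= N)%N ->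
  star_symbolic_power l c t f -> f != 0 -> (t * s <= c * (msize f).-1)%N.
Proof.
move=> c_bounds; have /andP[_ lecN] := c_bounds => ft f_neq0.
pose U : set 'X_{1..N.+1} := [set m : 'X_{1..N.+1} | (t * s <= c * mdeg m)%N].
have: supported_in U f.
  have := star_symbolic_power_span leNs l_general lecN ft; move: f {ft f_neq0}.
  apply: ideal_span_min => [|_ [a at_ ->] m mP].
    apply: is_ideal_supported => m m'; rewrite /U /= mdegD => /leq_trans; apply.
    by rewrite leq_mul2l leq_addr orbT.
  have : order_ge predT (\sum_i a i) m.
    move: m mP; apply: (@supported_in_exp K _ _ idfun predT (@irrelevant_ideal K N)).
      apply: ideal_span_min => [|_ [i ->] m].
        by apply: is_ideal_supported => m m'; apply: order_geDr.
      by rewrite /order_ge /= -mdegE msuppX inE => /eqP ->; rewrite mdeg1.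
    by apply: ideal_exp_prod => i _; apply: form_irrelevant.
  rewrite /order_ge /U /= -mdegE => le_deg.
  apply: leq_trans (star_exponent_degree c_bounds at_) _.
  by rewrite leq_mul2l le_deg orbT.
case suppE: (msupp f) => [|m r] Uf.
  by move/eqP: suppE; rewrite msupp_eq0 (negbTE f_neq0).
have fm : m \in msupp f by rewrite suppE inE eqxx.
apply: leq_trans (Uf _ fm) _; rewrite leq_mul2l; apply/orP; right.
by have := msize_mdeg_lt fm; lia.
Qed.

Lemma alpha_star_symbolic_power c m : (0 < c <= N)%N ->
  least_degree (star_symbolic_power l c m) (alpha (star_symbolic_power l c m)).
Proof.
move=> c_bounds; apply: (alphaP (f := \prod_i l i ^+ m)); last exact: form_prod_neq0.
apply: (@mem_star_symbolic_power K N s l c m (fun=> m)) => S Sc.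
rewrite sum_nat_const Sc; nia.
Qed.

Lemma alpha_lower_bound c t : (0 < c <= N)%N ->
  (t * s <= c * alpha (star_symbolic_power l c t))%N.
Proof.
move=> c_bounds; have [[f [ft f_neq0 <-]] _] := alpha_star_symbolic_power t c_bounds.
exact: star_symbolic_power_degree ft f_neq0.
Qed.

(** For [q] the round-up of [m / c], the exponents equal to [q], except for
    [c * q - m] of them equal to [q - 1], have sum at least [m] on each
    [c]-subset. *)
Lemma alpha_upper_bound c m q : (0 < c <= N)%N -> (0 < m)%N ->
  (m <= c * q < m + c)%N ->
  (alpha (star_symbolic_power l c m) <= m + (s - c) * q)%N.
Proof.
move=> c_bounds m_gt0 /andP[mq qm]; have /andP[c_gt0 lecN] := c_bounds.
pose r := (c * q - m)%N; have q_gt0 : (0 < q)%N by nia.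
pose a (i : 'I_s) := (q - (i < r))%N.
have aE (i : 'I_s) : (a i + (i < r) = q)%N by rewrite /a; case: (i < r)%N; lia.
have sum_r : (\sum_(i < s) (i < r)%N = r)%N.
  rewrite -big_mkcond /= -(big_ord_widen s (fun=> 1%N)) ?sum_nat_const ?card_ord; lia.
have am : star_exponent c m a.
  move=> S Sc; have : (\sum_(i in S) (a i + (i < r)) = c * q)%N.
    by under eq_bigr do rewrite aE; rewrite sum_nat_const Sc.
  rewrite big_split /=.
  have : (\sum_(i in S) (i < r)%N <= \sum_(i < s) (i < r)%N)%N.
    by rewrite [leqRHS](bigID (mem S)) leq_addr.
  rewrite sum_r /r; move: (\sum_(i in S) (i < _)%N)%N (\sum_(i in S) a i)%N => x y; lia.
have [_ /(_ _ (mem_star_symbolic_power l am) (form_prod_neq0 _))] :=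
  alpha_star_symbolic_power m c_bounds.
rewrite form_prod_degree => /leq_trans; apply.
have : (\sum_(i < s) (a i + (i < r)) = s * q)%N.
  by under eq_bigr do rewrite aE; rewrite sum_nat_const card_ord.
have le_cs : (c * q <= s * q)%N by apply: leq_mul => //; lia.
rewrite big_split /= sum_r mulnBl /r; move: (\sum_i _)%N => x; lia.
Qed.

(** The last three parts of the theorem are the cases [n = c], [n = N], and
    [n = N] with [m = 1]. *)
Lemma alpha_bound c n m t : (0 < c <= N)%N -> (c <= n)%N -> (0 < m)%N ->
  (0 < t)%N ->
  ((alpha (star_symbolic_power l c m))%:R + n%:R - 1) / (m%:R + n%:R - 1)
    <= (alpha (star_symbolic_power l c t))%:R / t%:R :> rat.
Proof.
move=> c_bounds lecn m_gt0 t_gt0; have /andP[c_gt0 lecN] := c_bounds.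
case: n lecn => [|n] lecn; first by lia.
pose q := ((m + c.-1) %/ c)%N.
have q_bounds : (m <= c * q < m + c)%N.
  by have := divn_eq (m + c.-1) c; have := ltn_pmod (m + c.-1) c_gt0; rewrite -/q; lia.
have := alpha_upper_bound c_bounds m_gt0 q_bounds.
have := alpha_lower_bound t c_bounds.
move: (alpha _) (alpha _) => y x tx ym.
have pred_natr (k : nat) : k%:R + n.+1%:R - 1 = (k + n)%:R :> rat.
  by rewrite -natr1 natrD; ring.
rewrite !pred_natr ler_pdivrMr ?ltr0n; last by lia.
rewrite mulrAC ler_pdivlMr ?ltr0n // -!natrM ler_nat.
rewrite -(leq_pmul2l c_gt0).
have [d sE] : exists d, s = (c + d)%N by exists (s - c)%N; lia.
move: tx ym; rewrite sE addKn => tx ym.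
have dq : (c * (d * q) <= d * (m + n))%N.
  by rewrite mulnCA leq_mul2l; apply/orP; right; lia.
have cy : (c * (y + n) <= (c + d) * (m + n))%N.
  have : (c * y <= c * (m + d * q))%N by rewrite leq_mul2l ym orbT.
  by rewrite !mulnDr !mulnDl in dq *; lia.
rewrite (mulnC _ t) mulnCA [leqRHS]mulnA.
apply: leq_trans (leq_mul tx (leqnn (m + n))).
by rewrite -mulnA leq_mul2l cy orbT.
Qed.

End InitialDegree.

Lemma star_symbolic_power1 (K : fieldType) (N s c : nat)
    (l : 'I_s -> {mpoly K[N.+1]}) :
  star_symbolic_power l c 1 = star_ideal l c.
Proof.
apply/seteqP; split=> f fS S /fS; last exact: ideal_exp1.
by apply: ideal_exp_sub => //; apply: is_ideal_forms.
Qed.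

Theorem proposition4p1 (K : fieldType) (N s c : nat)
    (H : 'I_s -> {vspace 'rV[K]_N.+1}) (l : 'I_s -> {mpoly K[N.+1]})
    (hs : (N.+1 <= s)%N)
    (hH : forall i, is_hyperplane (H i))
    (hdistinct : injective H)
    (hl : forall i, defining_form (l i) (H i))
    (hproper : meet_properly H)
    (hc : (1 <= c <= N)%N) :
  let I := star_ideal l c in
  let Isym := star_symbolic_power l c in
  let M := @irrelevant_ideal K N in
  forall m : nat, (1 <= m)%N ->
  [/\ (* 1 *)
      Isym (m * c)%N `<=` ideal_mul (ideal_exp M (m * (c - 1))) (ideal_exp I m)
      /\ (height I N ->
          Isym (m * N)%N
            `<=` ideal_mul (ideal_exp M (m * (N - 1))) (ideal_exp I m)),
      (* 2 *)
      Isym (m * c - c + 1)%N `<=` ideal_exp I m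
      /\ Isym (m * N - N + 1)%N `<=` ideal_exp I m,
      (* 3 *)
      Isym (m * c - c + 1)%N
        `<=` ideal_mul (ideal_exp M ((m - 1) * (c - 1))) (ideal_exp I m)
      /\ (height I N ->
          Isym (m * N - N + 1)%N
            `<=` ideal_mul (ideal_exp M ((m - 1) * (N - 1))) (ideal_exp I m))
    & [/\ (* 4 *)
          forall t : nat, (1 <= t)%N ->
            ((alpha (Isym m))%:R + c%:R - 1) / (m%:R + c%:R - 1)
              <= (alpha (Isym t))%:R / t%:R :> rat,
          (* 5 *)
          forall t : nat, (1 <= t)%N ->
            ((alpha (Isym m))%:R + N%:R - 1) / (m%:R + N%:R - 1)
              <= (alpha (Isym t))%:R / t%:R :> rat
        & (* 6 *)
          forall t : nat, (1 <= t)%N ->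
            ((alpha I)%:R + N%:R - 1) / N%:R
              <= (alpha (Isym t))%:R / t%:R :> rat]].
Proof.
move=> I Isym M m m_gt0.
have l_linear i : l i \is 1.-homog by case: (hl i).
have l_general := meet_properly_general_position hl hproper.
have containment q k : (k <= q - m)%N -> (m.-1 * c < q)%N ->
    Isym q `<=` ideal_mul (ideal_exp M k) (ideal_exp I m).
  move=> leqk ltq f /(star_symbolic_power_containment hs l_linear l_general hc ltq).
  apply: ideal_mul_min; first exact: is_ideal_mul.
  by move=> x y /(ideal_exp_decr leqk); apply: mem_ideal_mul.
have {}bound n t := @alpha_bound K N s l hs l_linear l_general c n m t hc.
have /andP[c_gt0 lecN] := hc.
split.
(* [c <= N] gives [m.-1 * c < m * N - N + 1 <= m * N]. *)
- by split=> [|_]; apply: containment; nia.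
- have weaken q : (m.-1 * c < q)%N -> Isym q `<=` ideal_exp I m.
    move=> ltq f /(containment q 0%N (leq0n _) ltq).
    exact: (ideal_mul_subr (is_ideal_exp I m)).
  by split; apply: weaken; nia.
- by split=> [|_]; apply: containment; nia.
split=> t t_gt0; [exact: bound | exact: bound |].
rewrite /I -star_symbolic_power1.
have := alpha_bound hs l_linear l_general hc lecN (ltn0Sn 0) t_gt0.
by rewrite [1%:R + _]addrC addrK.
Qed.
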